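(* Let $k$ be an algebraically closed field of characteristic $p>0$, let $q=p^e$ with $e\ge 1$, and let $X\subset\mathbb P^3_k$ be a smooth extremal surface of degree $q+1$. Then: (a) There are a total of $q^4+q^3+q+1=(q^3+1)(q+1)$ distinct lines on $X$, each containing exactly $q^2+1$ star points of $X$. (b) There are a total of $q^5+q^3+q^2+1=(q^3+1)(q^2+1)$ distinct stars on $X$, each containing exactly $q+1$ lines.
   Context: $k$ is an algebraically closed field of characteristic $p>0$ and $q=p^e$ with $e\ge1$. A Frobenius form in variables $x_1,\dots,x_n$ is a homogeneous polynomial of degree $q+1$ of the form $\sum_{i=1}^n x_i^{q}L_i$ with each $L_i$ a linear form. An extremal surface of degree $q+1$ is a surface in $\mathbb P^3_k$ defined by a Frobenius form of degree $q+1$ in four variables. A star on a smooth surface $X\subset\mathbb P^3$ of degree $d$ is a configuration of $d$ (distinct) lines on $X$ all meeting at one point $p$; the point $p$ is called the center of the star, or a star point of $X$. *)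

(* Defs.v *)
From mathcomp Require Import all_boot all_order all_algebra.
From mathcomp Require Import boolp classical_sets functions cardinality.
From mathcomp Require Import mpoly.

Set Implicit Arguments.
Unset Strict Implicit.
Unset Printing Implicit Defensive.

Import GRing.Theory.

Local Open Scope classical_set_scope.
Local Open Scope card_scope.
Local Open Scope ring_scope.

(* Points and lines of P^3 are the subspaces of k^4 of dimension 1 and 2, as  *)
(* elements of {vspace 'rV[k]_4}, on which Leibniz equality is equality of    *)
(* subspaces.  Incidence of a point P and a line L is (P <= L)%VS.  A surface *)
(* is represented by a form F in four variables.                              *)

Definition frobenius_form (k : fieldType) (n q : nat) (F : {mpoly k[n]}) : Prop :=
  F \is q.+1.-homog /\
  exists L : 'I_n -> {mpoly k[n]},
    (forall i, L i \is 1.-homog) /\ F = \sum_(i < n) 'X_i ^+ q * L i.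

(* Jacobian criterion at every k-point of V(F) (v is a vector of homogeneous  *)
(* coordinates); it also forces F to be nonzero.  The polynomial F itself is  *)
(* required to vanish at v because Euler's relation does not suffice when the *)
(* characteristic divides the degree.                                         *)
Definition smooth_surface (k : closedFieldType) (F : {mpoly k[4]}) : Prop :=
  forall v : 'rV[k]_4, v != 0 -> F.@[v 0] = 0 -> exists i, (F^`M(i)).@[v 0] != 0.

Definition is_point (k : fieldType) (P : {vspace 'rV[k]_4}) : Prop :=
  (\dim P = 1)%N.

Definition is_line (k : fieldType) (L : {vspace 'rV[k]_4}) : Prop :=
  (\dim L = 2)%N.

(* Containment is tested on k-points, which is enough since k is infinite.    *)
Definition line_on (k : closedFieldType) (F : {mpoly k[4]})
    (L : {vspace 'rV[k]_4}) : Prop :=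
  is_line L /\ forall v, v \in L -> F.@[v 0] = 0.

Definition star_centered_at (k : closedFieldType) (d : nat) (F : {mpoly k[4]})
    (P : {vspace 'rV[k]_4}) (S : set {vspace 'rV[k]_4}) : Prop :=
  [/\ is_point P, S #= `I_d
    & forall L, S L -> line_on F L /\ (P <= L)%VS].

Definition star (k : closedFieldType) (d : nat) (F : {mpoly k[4]})
    (S : set {vspace 'rV[k]_4}) : Prop :=
  exists P, star_centered_at d F P S.

Definition star_point (k : closedFieldType) (d : nat) (F : {mpoly k[4]})
    (P : {vspace 'rV[k]_4}) : Prop :=
  exists S, star_centered_at d F P S.

(* Main.v *)
Require Import Defs.
From HB Require Import structures.
From mathcomp Require Import all_boot all_order all_algebra separable.
From mathcomp Require Import boolp classical_sets functions cardinality.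
From mathcomp Require Import mpoly ring zify.

(* Write the form as F(x) = h(x, x) with h(x, y) = x^(q) A y^T, additive in
   both arguments and q-Frobenius semilinear in the first; smoothness makes h
   nondegenerate.  Define T by h(y, T x) = h(x, y)^q; it is q^2-semilinear and
   injective.  A line L lies on X iff it is totally isotropic, and then L is its
   own orthogonal, so T L <= L.  Hence a point on two lines of X is T-stable, and
   the star points are exactly the T-stable isotropic points (the F_{q^2}-points
   of a Hermitian surface).  A nondegenerate binary form
   x^Q (a x + b y) + y^Q (c x + d y) is separable, so it has Q + 1 zeros on P^1:
   with Q = q this counts the lines through a star point (q + 1), with Q = q^2
   the star points on a line (q^2 + 1).  A star point exists since T has fixed
   vectors on T-stable subspaces.  Finally a star point R off a line L of X is
   joined by a line of X to exactly one star point of L, so the star points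
   number (q^2+1) + (q^2+1) q q^2, and counting flags gives the lines. *)

Set Implicit Arguments.
Unset Strict Implicit.
Unset Printing Implicit Defensive.

Import GRing.Theory.

Local Open Scope ring_scope.

(** * Finite cardinalities by enumeration *)

(** An explicit duplicate-free list is easy to concatenate, filter and sum over; [has_size_card]
    converts the result to [#=] only at the end. *)
Definition has_size (T : eqType) (n : nat) (A : T -> Prop) : Prop :=
  exists s : seq T, [/\ uniq s, size s = n & forall x, A x <-> x \in s].

Lemma has_size_card (T : choiceType) (n : nat) (A : set T) :
  has_size n A -> (A #= `I_n)%card.
Proof.
move=> [s [us <- As]].
have /perm_size := finmap.seq_fset_perm tt s.
rewrite undup_id // => /card_eq_fsetP.
congr (is_true (_ #= _)%card); apply/seteqP.
by split=> x H; [apply/As|move/As: H];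
  rewrite -(finmap.seq_fsetE tt).
Qed.

Lemma has_size_ext (T : eqType) (n : nat) (A B : T -> Prop) :
  (forall x, A x <-> B x) -> has_size n A -> has_size n B.
Proof. by move=> AB [s [us ss As]]; exists s; split=> // x; rewrite -AB. Qed.

Lemma has_size_map (T U : eqType) (n : nat) (A : T -> Prop) (f : T -> U) :
  (forall x y, A x -> A y -> f x = f y -> x = y) ->
  has_size n A -> has_size n (fun u => exists2 x, A x & u = f x).
Proof.
move=> finj [s [us ss As]]; exists (map f s); split.
- by rewrite map_inj_in_uniq // => x y /As Ax /As Ay; apply: finj.
- by rewrite size_map.
- move=> u; split=> [[x Ax ->]|/mapP[x /As Ax ->]]; last by exists x.
  by apply/map_f/As.
Qed.

Lemma has_size_D1 (T : eqType) (n : nat) (A : T -> Prop) (x : T) :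
  A x -> has_size n.+1 A -> has_size n (fun y => A y /\ y <> x).
Proof.
move=> Ax [s [us ss As]]; exists (rem x s); split.
- exact: rem_uniq.
- by rewrite size_rem ?ss //; apply/As.
- move=> y; rewrite mem_rem_uniq // inE /=.
  by split=> [[/As -> /eqP ->]//|/andP[/eqP yx /As]].
Qed.

Lemma has_size_U (T : eqType) (m n : nat) (A B : T -> Prop) :
  (forall x, A x -> B x -> False) -> has_size m A -> has_size n B ->
  has_size (m + n) (fun x => A x \/ B x).
Proof.
move=> AB [s [us <- As]] [t [ut <- Bt]]; exists (s ++ t); split.
- rewrite cat_uniq us ut /= andbT; apply/hasPn => x /Bt Bx.
  by apply/negP => /As Ax; apply: (AB x).
- by rewrite size_cat.
- by move=> x; rewrite mem_cat; split=> [[/As|/Bt] ->|/orP[/As|/Bt]];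
     rewrite ?orbT //; [left|right].
Qed.

(** Choice makes the enumerations depend on [x] through a function; outside [B] its value is the
    arbitrary [[::]]. *)
Lemma has_size_fun (T U : eqType) (n : nat) (A : T -> U -> Prop)
    (B : T -> Prop) :
  (forall x, B x -> has_size n (A x)) ->
  exists f : T -> seq U, forall x, B x ->
    [/\ uniq (f x), size (f x) = n & forall y, A x y <-> y \in f x].
Proof.
move=> BA; suff /choice[f fP] : forall x, exists r, B x ->
    [/\ uniq r, size r = n & forall y, A x y <-> y \in r] by exists f.
move=> x.
have [Bx|nBx] := pselect (B x); last by exists [::] => /nBx.
by have [s sP] := BA x Bx; exists s.
Qed.

Lemma has_size_bigU (T U : eqType) (m n : nat) (B : T -> Prop)
    (A : T -> U -> Prop) :
  (forall x x' y, B x -> B x' -> A x y -> A x' y -> x = x') ->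
  has_size m B -> (forall x, B x -> has_size n (A x)) ->
  has_size (m * n) (fun y => exists x, B x /\ A x y).
Proof.
move=> disj [s [us <- Bs]] Am.
have {Am} : {in s, forall x, has_size n (A x)} by move=> x /Bs; apply: Am.
have {disj} : {in s &, forall x x' y, A x y -> A x' y -> x = x'}.
  by move=> x x' /Bs Bx /Bs Bx' y; apply: disj.
suff H : {in s &, forall x x' y, A x y -> A x' y -> x = x'} ->
    {in s, forall x, has_size n (A x)} ->
    has_size (size s * n) (fun y => exists x, x \in s /\ A x y).
  move=> disj As; apply: has_size_ext (H disj As) => y.
  by split=> -[x [/Bs Bx Axy]]; exists x.
elim: s us {Bs} => [_ _ _|x s IH /= /andP[xs us] disj As].
  by exists [::]; split=> // y; split=> // -[x []].
have IHs : has_size (size s * n) (fun y => exists z, z \in s /\ A z y).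
  apply: IH => // [z z' zs z's|z zs]; last by apply: As; rewrite inE zs orbT.
  by apply: disj; rewrite inE ?zs ?z's orbT.
have Ax : has_size n (A x) by apply: As; rewrite mem_head.
rewrite mulSn; apply: has_size_ext (has_size_U _ Ax IHs).
- move=> y; split=> [[Axy|[z [zs Azy]]]|[z [+ Azy]]].
  + by exists x; rewrite mem_head.
  + by exists z; rewrite inE zs orbT.
  + by rewrite inE => /orP[/eqP zx|zs]; [left; rewrite -zx|right; exists z].
- move=> y Axy [z [zs Azy]]; move: xs.
  by rewrite (disj x z _ _ y Axy Azy) ?zs // inE ?eqxx ?zs ?orbT.
Qed.

(** Finiteness of [B] is a conclusion: since [0 < a], each [y] in [B] is incident to some [x] in
    [A], so it occurs in one of finitely many lists. The identity then comes from summing the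
    incidences in both orders. *)
Lemma has_size_double_count (T U : eqType) (m a b : nat) (A : T -> Prop)
    (B : U -> Prop) (I : T -> U -> Prop) :
  (0 < a)%N -> has_size m A ->
  (forall x, A x -> has_size b (fun y => B y /\ I x y)) ->
  (forall y, B y -> has_size a (fun x => A x /\ I x y)) ->
  exists2 n, has_size n B & (n * a = m * b)%N.
Proof.
move=> a0 [s [us <- As]] /has_size_fun[f fP] Ba.
pose t := undup (flatten (map f s)).
have Bt y : B y <-> y \in t.
  rewrite mem_undup; split=> [By|/flatten_mapP[x /As Ax]].
    have [[|x r] [_ rsize rP]] := Ba y By; first by rewrite -rsize in a0.
    have [Ax Ixy] := (rP x).2 (mem_head _ _).
    apply/flatten_mapP; exists x; first exact/As.
    by have [_ _ fx] := fP x Ax; apply/fx.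
  by have [_ _ fx] := fP x Ax => /fx[].
exists (size t); first by exists t; rewrite undup_uniq.
have cT y : y \in t -> count (fun x => `[< I x y >]) s = a.
  move=> /Bt /Ba[r [ur <- rP]]; rewrite -size_filter; apply: perm_size.
  apply: uniq_perm; rewrite ?filter_uniq // => x.
  rewrite mem_filter; apply/andP/idP => [[/asboolP Ixy /As Ax]|/rP[/As]].
    exact/rP.
  by move=> xs /asboolP.
have cS x : x \in s -> count (fun y => `[< I x y >]) t = b.
  move=> /As Ax; have [uf <- fx] := fP x Ax.
  rewrite -size_filter; apply: perm_size.
  apply: uniq_perm; rewrite ?filter_uniq ?undup_uniq // => y.
  rewrite mem_filter; apply/andP/idP => [[/asboolP Ixy /Bt By]|/fx[/Bt]].
    exact/fx.
  by move=> yt /asboolP.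
have cE (V : eqType) (r : seq V) (c : nat) (g : V -> nat) :
    (forall x, x \in r -> g x = c) -> (\sum_(x <- r) g x = size r * c)%N.
  move=> rc; rewrite (eq_big_seq (fun=> c)) => [|x xr]; last exact: rc.
  by rewrite big_const_seq count_predT iter_addn_0 mulnC.
rewrite -(cE _ _ _ _ cT) -(cE _ _ _ _ cS).
under eq_bigr do rewrite -sum1_count big_mkcond /=.
rewrite exchange_big; apply: eq_bigr => x _.
by rewrite -big_mkcond sum1_count.
Qed.

(** * Binary Frobenius forms *)

Lemma pchar_nat_eq0 (k : fieldType) (q : nat) :
  [pchar k].-nat q -> (1 < q)%N -> q%:R = 0 :> k.
Proof.
move=> qk q1; apply/eqP/negPn; rewrite natf_neq0_pchar; apply/negP => qk'.
by rewrite (pnat_1 qk qk') in q1.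
Qed.

Lemma closed_root_exists (k : closedFieldType) (n : nat) (a : k) :
  (0 < n)%N -> exists x, x ^+ n = a.
Proof.
move=> n0; have /closed_rootP[x] : size ('X^n - a%:P) != 1%N.
  by rewrite size_XnsubC //; case: n n0.
by rewrite /root !hornerE subr_eq0 => /eqP <-; exists x.
Qed.

(** This is the affine chart [(1, t)] of the binary form. The degree falls from [Q + 1] to [Q]
    exactly when [d = 0], that is, when the point at infinity is a zero. *)
Lemma binary_form_roots (k : closedFieldType) (Q : nat) (a b c d : k) :
  [pchar k].-nat Q -> (1 < Q)%N -> a * d - b * c != 0 ->
  has_size (Q + (d != 0)) (fun t => a + b * t + t ^+ Q * (c + d * t) = 0).
Proof.
move=> Qk Q1 det; have Q0 := ltnW Q1.
pose g : {poly k} := a%:P + b *: 'X + 'X^Q * (c%:P + d *: 'X).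
have gE t : g.[t] = a + b * t + t ^+ Q * (c + d * t) by rewrite !hornerE.
have g'E t : g^`().[t] = b + d * t ^+ Q.
  rewrite /g !derivE !hornerE hornerMn -mulr_natr (pchar_nat_eq0 Qk Q1) /=.
  by rewrite !mulr0 !mul0r; ring.
have gsize : size g = (Q + (d != 0)).+1.
  have alow : (size (a%:P + b *: 'X : {poly k})%R <= Q)%N.
    apply: leq_trans (size_polyD _ _) _; rewrite geq_max.
    rewrite (leq_trans (size_polyC_leq1 _)) //.
    by rewrite (leq_trans (size_scale_leq _ _)) // size_polyX.
  have e : size ('X^Q * (c%:P + d *: 'X)) = (Q + (d != 0)).+1.
    have [d0|d0] := eqVneq d 0.
      have c0 : c != 0 by apply: contraNneq det => ->; rewrite d0 !mulr0 subr0.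
      rewrite d0 scale0r addr0 mulrC size_mulXn ?polyC_eq0 // size_polyC c0.
      by rewrite addn0 addn1.
    have sd : size (c%:P + d *: 'X) = 2%N.
      rewrite addrC size_polyDl size_scale ?size_polyX //.
      by rewrite (leq_ltn_trans (size_polyC_leq1 _)).
    by rewrite mulrC size_mulXn ?sd ?addn2 ?addn1 // -size_poly_eq0 sd.
  by rewrite /g addrC size_polyDl e // ltnS (leq_trans alow) // leq_addr.
have g0 : g != 0 by rewrite -size_poly_eq0 gsize.
have [r gr] := closed_field_poly_normal g.
have lg : lead_coef g != 0 by rewrite lead_coef_eq0.
(* As [Q = 0] in [k], the derivative is [b + d t^Q], and [d g - g' (c + d t) = a d - b c] is a
   nonzero constant; hence [g] and [g'] have no common root. *)
have sg : separable_poly g.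
  rewrite unlock; apply/Pdiv.ClosedField.coprimepP => t.
  rewrite /root gE g'E => /eqP gt0; apply: contraNneq det => g't0.
  apply/eqP; transitivity (d * (a + b * t + t ^+ Q * (c + d * t))
    - (b + d * t ^+ Q) * (c + d * t)); first by ring.
  by rewrite gt0 g't0 mulr0 mul0r subr0.
exists r; split.
- rewrite -separable_prod_XsubC -(eqp_separable (eqp_scale _ lg)).
  by rewrite -gr.
- by apply/eqP; rewrite -eqSS -gsize gr size_scale // size_prod_XsubC.
- move=> t; rewrite -gE; split=> [/eqP|tr]; last first.
    by apply/eqP; rewrite -[_ == 0]/(root g t) gr rootZ // root_prod_XsubC.
  by rewrite -[_ == 0]/(root g t) gr rootZ // root_prod_XsubC.
Qed.

Lemma det2_kernel (k : fieldType) (a b c d : k) : a * d - b * c = 0 ->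
  exists u v, [/\ u * a + v * c = 0, u * b + v * d = 0 & (u != 0) || (v != 0)].
Proof.
move/eqP; rewrite subr_eq0 => /eqP det.
have [a0|a0] := eqVneq a 0; last first.
  by exists c, (- a); split; rewrite ?oppr_eq0 ?a0 ?orbT // mulNr 1?det; ring.
have [b0|b0] := eqVneq b 0; last first.
  exists d, (- b); split; rewrite ?oppr_eq0 ?b0 ?orbT // mulNr.
    by rewrite [d * a]mulrC det subrr.
  ring.
by exists 1, 0; rewrite a0 b0 oner_eq0 !mulr0 !mul0r !addr0.
Qed.

(** * Points and lines as subspaces of dimension 1 and 2 *)

Section Subspaces.
Variables (k : fieldType) (V : vectType k).
Implicit Types (u v x y : V) (U W : {vspace V}).

Lemma vline_scale (c : k) v : c != 0 -> <[c *: v]>%VS = <[v]>%VS.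
Proof.
move=> c0; apply/eqP; rewrite eqEsubv -!memvE memvZ ?memv_line //=.
by apply/vlineP; exists c^-1; rewrite scalerA mulVf ?scale1r.
Qed.

Lemma vline_eq u v : u != 0 -> u \in <[v]>%VS -> <[u]>%VS = <[v]>%VS.
Proof.
move=> u0 /vlineP[c uE]; rewrite uE vline_scale //.
by apply: contraNneq u0 => c0; rewrite uE c0 scale0r.
Qed.

Lemma free2P u v : free [:: u; v] = (u \notin <[v]>%VS) && (v != 0).
Proof. by rewrite free_cons span_seq1 seq1_free. Qed.

Lemma free2_eq0 u v (x y : k) :
  free [:: u; v] -> x *: u + y *: v = 0 -> x = 0 /\ y = 0.
Proof.
rewrite free2P => /andP[uv v0] E; have [x0|x0] := eqVneq x 0.
  move: E; rewrite x0 scale0r add0r => /eqP.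
  by rewrite scaler_eq0 (negPf v0) orbF => /eqP.
case/negP: uv; apply/vlineP; exists (- (x^-1 * y)).
apply: (scalerI x0); rewrite scalerA mulrN mulrA mulfV // mul1r scaleNr.
by apply/eqP; rewrite -addr_eq0 E.
Qed.

Lemma free2I u v : (forall x y : k, x *: u + y *: v = 0 -> x = 0 /\ y = 0) ->
  free [:: u; v].
Proof.
move=> H; rewrite free2P; apply/andP; split.
  apply/negP => /vlineP[c uE]; have [|/eqP] := H 1 (- c).
    by rewrite uE scale1r scaleNr subrr.
  by rewrite oner_eq0.
apply/eqP => v0; have [|_ /eqP] := H 0 1.
  by rewrite v0 scale0r scaler0 addr0.
by rewrite oner_eq0.
Qed.

(** Proportionality of coordinate vectors is the vanishing of a 2 by 2 determinant; this turns
    stability of a point under [T] into a binary equation. *)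
Lemma line2_mem u v (x y a b : k) : free [:: u; v] -> x *: u + y *: v != 0 ->
  (a *: u + b *: v \in <[x *: u + y *: v]>%VS) <-> a * y - b * x = 0.
Proof.
move=> uv xy0; split=> [/vlineP[c]|E].
  rewrite scalerDr !scalerA => /eqP; rewrite -subr_eq0 opprD addrACA.
  rewrite -!scalerBl => /eqP /(free2_eq0 uv)[/eqP + /eqP].
  rewrite !subr_eq0 => /eqP -> /eqP ->; ring.
have [x0|x0] := eqVneq x 0.
  have y0 : y != 0 by apply: contraNneq xy0 => y0; rewrite x0 y0 !scale0r addr0.
  move/eqP: E; rewrite x0 mulr0 subr0 mulf_eq0 (negPf y0) orbF => /eqP ->.
  apply/vlineP; exists (b / y).
  by rewrite !scale0r !add0r scalerA divfK.
apply/vlineP; exists (a / x); rewrite scalerDr !scalerA divfK //.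
congr (_ + _ *: _); apply: (mulfI x0); move/eqP: E; rewrite subr_eq0 => /eqP E.
by rewrite mulrC -E; field.
Qed.

Lemma memv_line2P u v x :
  reflect (exists a b, x = a *: u + b *: v) (x \in <[u]> + <[v]>)%VS.
Proof.
apply: (iffP memv_addP) => [[y /vlineP[a ->] [z /vlineP[b ->] ->]]|].
  by exists a, b.
by move=> [a [b ->]]; exists (a *: u); [|exists (b *: v)]; rewrite ?memvZ ?memv_line.
Qed.

Lemma dim_line2 u v : free [:: u; v] -> \dim (<[u]> + <[v]>) = 2%N.
Proof. by rewrite -(span_seq1 v) -span_cons => /eqP. Qed.

Lemma line2_basis U : \dim U = 2%N ->
  exists u v, free [:: u; v] /\ U = (<[u]> + <[v]>)%VS.
Proof.
move=> U2; have := vbasisP U; case: (vbasis U) => s /=; rewrite U2.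
case: s => [|u [|v [|]]] //= _ /andP[/eqP sU fuv].
by exists u, v; rewrite -sU span_cons span_seq1.
Qed.

Lemma line2E U u v : \dim U = 2%N -> free [:: u; v] -> u \in U -> v \in U ->
  U = (<[u]> + <[v]>)%VS.
Proof.
move=> U2 uv uU vU; apply/esym/eqP.
by rewrite eqEdim subv_add -!memvE uU vU dim_line2 // U2.
Qed.

Lemma line2_inj U W u v : \dim U = 2%N -> \dim W = 2%N -> free [:: u; v] ->
  u \in U -> v \in U -> u \in W -> v \in W -> U = W.
Proof. by move=> *; rewrite (@line2E U u v) // (@line2E W u v). Qed.

End Subspaces.

Lemma binary_form_points (k : closedFieldType) (V : vectType k) (Q : nat)
    (a b c d : k) (u v : V) :
  [pchar k].-nat Q -> (1 < Q)%N -> a * d - b * c != 0 -> free [:: u; v] ->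
  has_size Q.+1 (fun P => exists x y, [/\ x *: u + y *: v != 0,
    P = <[x *: u + y *: v]>%VS
    & x ^+ Q * (a * x + b * y) + y ^+ Q * (c * x + d * y) = 0]).
Proof.
move=> Qk Q1 det uv; have Q0 := ltnW Q1.
have v0 : v != 0 by move: uv; rewrite free2P => /andP[].
have utv t : u + t *: v != 0.
  apply/eqP; rewrite -[u]scale1r => /(free2_eq0 uv)[/eqP].
  by rewrite oner_eq0.
have roots := binary_form_roots Qk Q1 det.
have lines := has_size_map (f := fun t => <[u + t *: v]>%VS) _ roots.
(* The boolean [d == 0] serves as the number 0 or 1: the point at infinity [<[v]>] makes up for the
   root lost when [d = 0]. *)
have inf : has_size (d == 0) (fun P => d = 0 /\ P = <[v]>%VS).
  have [d0|d0] := eqVneq d 0.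
    exists [:: <[v]>%VS]; split=> // P; rewrite inE.
    by split=> [[_ ->]//|/eqP].
  by exists [::]; split=> // P; split=> // -[/eqP]; rewrite (negPf d0).
rewrite -(_ : Q + (d != 0%R) + (d == 0%R) = Q.+1)%N; last first.
  by case: eqP; rewrite ?addn0 ?addn1.
apply: has_size_ext (has_size_U _ (lines _) inf).
- move=> P; split=> [[[t gt ->]|[d0 ->]]|[x [y [xy0 -> gxy]]]].
  + exists 1, t; rewrite scale1r; split=> //; rewrite -gt expr1n; ring.
  + exists 0, 1; rewrite scale0r add0r scale1r; split=> //.
    by rewrite d0 expr0n gtn_eqF // !(mul0r, mulr0, addr0).
  have [x0|x0] := eqVneq x 0.
    right; move: xy0 gxy; rewrite x0 scale0r add0r scaler_eq0 negb_or.
    move=> /andP[y0 _]; rewrite vline_scale // expr0n gtn_eqF //.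
    rewrite mul0r mulr0 !add0r => /eqP; rewrite !mulf_eq0 expf_eq0.
    by rewrite (negPf y0) andbF orbF /= => /eqP.
  left; exists (y / x).
    (* By homogeneity, the equation at [y / x] times [x^(Q+1)] is the equation at [(x, y)]. *)
    apply: (mulfI (expf_neq0 Q.+1 x0)); rewrite mulr0 -[RHS]gxy exprS expr_div_n.
    by field; rewrite x0 expf_neq0.
  by rewrite -(vline_scale (u + _) x0) scalerDr scalerA mulrCA mulfV ?mulr1.
- move=> P [t _ ->] [_ E].
  have /vlineP[z] : u + t *: v \in <[v]>%VS by rewrite -E memv_line.
  move/eqP; rewrite -subr_eq0 -addrA -scalerBl -[u]scale1r => /eqP.
  by move=> /(free2_eq0 uv)[/eqP]; rewrite oner_eq0.
- move=> t s _ _ E.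
  have /vlineP[z] : u + t *: v \in <[u + s *: v]>%VS by rewrite -E memv_line.
  move=> Ez; have : (1 - z) *: u + (t - z * s) *: v = 0.
    rewrite !scalerBl scale1r addrACA Ez scalerDr -opprD scalerA.
    by rewrite subrr.
  move=> /(free2_eq0 uv)[/eqP]; rewrite subr_eq0 => /eqP <-.
  by rewrite mul1r => /eqP; rewrite subr_eq0 => /eqP.
Qed.

(** * Fixed vectors of Frobenius-semilinear maps *)

(* Solves [c 0 = a 0 * r ^+ Q], [c i.+1 = c i ^+ Q + a i.+1 * r ^+ Q] and
   [c n = r] with [r != 0]: writing [c i = r ^+ Q * R_i(r)], the last equation
   becomes [r ^+ Q.-1 * R_n(r) = 1]. *)
Lemma frobenius_recurrence (k : closedFieldType) (Q n : nat) (a : nat -> k) :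
  (1 < Q)%N -> (exists2 i, (i <= n)%N & a i != 0) ->
  exists c : nat -> k, [/\ c n != 0, c 0%N = a 0%N * c n ^+ Q
    & forall i, c i.+1 = c i ^+ Q + a i.+1 * c n ^+ Q].
Proof.
move=> Q1 [j jn aj]; have Q0 := ltnW Q1.
have Q10 : (0 < Q.-1)%N by case: Q Q1 {Q0} => [|[]].
(* The exponent [Q * Q - Q] is what remains of [(r^Q R_i(r))^Q] once a factor [r^Q] is taken out. *)
pose fix R i : {poly k} := if i is i'.+1 then
  'X^(Q * Q - Q) * R i' ^+ Q + (a i)%:P else (a 0%N)%:P.
have QQ : (0 < Q * Q - Q)%N by rewrite subn_gt0 -{1}[Q]muln1 ltn_pmul2l.
(* The constant term of [R i] is [a i], so if [R i] vanishes then so does [a i], and then [R] at the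
   preceding index. *)
have RE i : R i = 0 -> forall j, (j <= i)%N -> a j = 0.
  elim: i => [|i IH] /= R0 l.
    by rewrite leqn0 => /eqP ->; apply/eqP; rewrite -polyC_eq0 R0.
  have ai : a i.+1 = 0.
    move/(congr1 (fun p => p.[0])): R0.
    by rewrite !hornerE expr0n gtn_eqF // mul0r add0r.
  move: R0; rewrite ai addr0 => /eqP; rewrite mulf_eq0 expf_eq0.
  rewrite polyX_eq0 andbF /= expf_eq0 => /andP[_ /eqP Ri].
  by rewrite leq_eqVlt => /orP[/eqP ->//|]; apply: IH.
have Rn : R n != 0 by apply: contraNneq aj => /RE ->.
have /closed_rootP[r] : size ('X^(Q.-1) * R n - 1) != 1%N.
  have sR : (1 < size ('X^(Q.-1) * R n)%R)%N.
    rewrite mulrC size_mulXn // -(prednK Q10) addSn ltnS.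
    by rewrite (leq_trans _ (leq_addl _ _)) // size_poly_gt0.
  rewrite size_polyDl ?gtn_eqF // size_polyN size_poly1 //.
rewrite /root !hornerE subr_eq0 => /eqP rR.
have r0 : r != 0.
  by apply/eqP => r0; move/eqP: rR; rewrite r0 expr0n gtn_eqF // mul0r eq_sym oner_eq0.
have rE : r ^+ Q * (R n).[r] = r by rewrite -(prednK Q0) exprS -mulrA rR mulr1.
exists (fun i => r ^+ Q * (R i).[r]); rewrite rE; split=> // [|i].
  by rewrite /= hornerC mulrC.
rewrite /= !hornerE mulrDr exprMn -exprM [_ * a _]mulrC mulrA -exprD.
by rewrite subnKC ?leq_pmulr.
Qed.

(** Let [w i] be the iterates of a nonzero vector and [w n.+1] the first that is a combination
    [sum a_i w_i] of its predecessors. Comparing coefficients in [T x = x] for [x = sum c_i w_i]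
    gives exactly the system solved by [frobenius_recurrence]. *)
Lemma frobenius_fixed_vector (k : closedFieldType) (V : vectType k) (Q : nat)
    (T : V -> V) (W : {vspace V}) :
  (1 < Q)%N -> (forall x y, T (x + y) = T x + T y) ->
  (forall c x, T (c *: x) = c ^+ Q *: T x) -> (forall x, T x = 0 -> x = 0) ->
  (forall x, x \in W -> T x \in W) -> W != 0%VS ->
  exists x, [/\ x \in W, x != 0 & T x = x].
Proof.
move=> Q1 TD TZ Tinj TW W0; have Q0 := ltnW Q1.
pose v := vpick W; have v0 : v != 0 by rewrite vpick0.
pose w i := iter i T v.
have w0 i : w i != 0.
  by elim: i => //= i wi; apply: contraNneq wi => /Tinj ->.
have wW i : w i \in W by elim: i => [|i IH]; [apply: memv_pick | apply: TW].
pose S m := (\sum_(i < m) <[w i]>)%VS.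
have T0 : T 0 = 0 by rewrite -(scale0r 0) TZ expr0n gtn_eqF // !scale0r.
have Tsum n (c : 'I_n -> k) : T (\sum_(i < n) c i *: w i)
    = \sum_(i < n) c i ^+ Q *: w i.+1.
  elim: n c => [c|n IH c]; first by rewrite !big_ord0.
  by rewrite !big_ord_recr /= TD IH TZ.
(* Otherwise the spans [S m] would grow beyond the dimension of [V]. *)
have exS : exists m, w m \in S m.
  apply: contrapT => nS; have nwS m : w m \notin S m.
    by apply/negP => wS; apply: nS; exists m.
  have dS m : (m <= \dim (S m))%N.
    elim: m => // m /leq_ltn_trans; apply.
    have SS : (S m <= S m.+1)%VS by rewrite /S big_ord_recr addvSl.
    rewrite (ltn_leqif (dimv_leqif_eq SS)); apply/negP => /eqP SE.
    by case/negP: (nwS m); rewrite SE memvE /S big_ord_recr addvSr.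
  have := leq_trans (dS (\dim {:V}).+1) (dimvS (subvf _)).
  by rewrite ltnn.
case: (ex_minnP exS) => -[|n] wn minn.
  by move: wn (w0 0%N); rewrite /S big_ord0 memv0 => ->.
have nwn : w n \notin S n by apply/negP => /minn; rewrite ltnn.
have [a aE] : exists a : nat -> k, w n.+1 = \sum_(i < n.+1) a i *: w i.
  have /memv_sumP[vs vsw ->] := wn.
  have /fin_all_exists[a aE] : forall i : 'I_n.+1, exists a, vs i = a *: w i.
    by move=> i; apply/vlineP/vsw.
  by exists (fun i => a (inord i)); apply: eq_bigr => i _; rewrite inord_val.
(* The [a i] are not all zero, since injectivity of [T] keeps [w n.+1] nonzero. *)
have [|c [cn c0 cS]] := @frobenius_recurrence k Q n a Q1.
  apply: contrapT => na; case/eqP: (w0 n.+1); rewrite aE big1 // => i _.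
  apply/eqP; rewrite scaler_eq0; apply/orP; left; apply/negPn/negP => ai.
  by apply: na; exists i; rewrite // -ltnS.
exists (\sum_(i < n.+1) c i *: w i); split.
- by apply: memv_suml => i _; rewrite memvZ.
(* As [c n] is nonzero, a vanishing sum would put [w n] in the span of the earlier iterates, against
   minimality. *)
- apply: contraNneq nwn => /eqP; rewrite big_ord_recr /= addr_eq0 => /eqP E.
  have : c n *: w n \in S n.
    rewrite -[_ *: _]opprK -E rpredN; apply: memv_sumr => i _.
    by rewrite memvZ ?memv_line.
  by rewrite rpredZeq (negPf cn).
- have wS i : w i.+1 = T (w i) by [].
  rewrite Tsum [RHS]big_ord_recl /= c0 big_ord_recr /= -wS aE.
  rewrite big_ord_recl scalerDr addrCA scalerA mulrC; congr (_ + _).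
  rewrite scaler_sumr -big_split; apply: eq_bigr => i _ /=.
  by rewrite cS scalerDl scalerA [a _ * _]mulrC.
Qed.

(** * The geometry of a Frobenius form in four variables *)

Section FrobeniusGeometry.

Variables (k : closedFieldType) (q : nat) (V : vectType k).
Variables (h : V -> 'Hom(V, k^o)) (T : V -> V).
Hypotheses (qk : [pchar k].-nat q) (q1 : (1 < q)%N).
Hypothesis dimV : \dim {:V} = 4%N.
Hypothesis hD : forall x y, h (x + y) = h x + h y.
Hypothesis hZ : forall c x, h (c *: x) = c ^+ q *: h x.
Hypothesis h_inj : forall x, h x = 0 -> x = 0.
Hypothesis h_nondeg : forall y, (forall x, h x y = 0) -> y = 0.
Hypothesis hT : forall x y, h y (T x) = (h x y : k) ^+ q.

Definition isoline (L : {vspace V}) : Prop :=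
  \dim L = 2%N /\ forall x y, x \in L -> y \in L -> h x y = 0.

(* A rational point of the Hermitian surface: the [F_{q^2}]-structure enters only
   through the stability of the point under [T]. *)
Definition hermpoint (P : {vspace V}) : Prop :=
  exists x, [/\ x != 0, P = <[x]>%VS, h x x = 0 & T x \in <[x]>%VS].

Let q0 : (0 < q)%N. Proof. exact: ltnW. Qed.

Let hDl x y z : h (x + y) z = h x z + h y z.
Proof. by rewrite hD add_lfunE. Qed.

Let hZl c x y : h (c *: x) y = c ^+ q * h x y :> k.
Proof. by rewrite hZ scale_lfunE. Qed.

Let hZr c x y : h x (c *: y) = c * h x y :> k.
Proof. by rewrite linearZ. Qed.

Let h_neq0 x : x != 0 -> exists y, h x y != 0.
Proof.
move=> x0; apply: contrapT => nh; case/eqP: x0; apply: h_inj.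
apply/lfunP => y; rewrite zero_lfunE; apply/eqP/negPn/negP => hxy.
by apply: nh; exists y.
Qed.

(** By [h_nondeg] a vector is determined by its pairings [h z], so the semilinearity of [T] can be
    read off from [hT]. *)
Let TD x y : T (x + y) = T x + T y.
Proof.
apply/eqP; rewrite -subr_eq0; apply/eqP/h_nondeg => z.
rewrite linearB linearD /= !hT hDl exprDn_pchar // subrr //.
Qed.

Let TZ c x : T (c *: x) = c ^+ (q * q) *: T x.
Proof.
apply/eqP; rewrite -subr_eq0; apply/eqP/h_nondeg => z.
by rewrite linearB /= hZr !hT hZl exprMn exprM subrr.
Qed.

Let T_inj x : T x = 0 -> x = 0.
Proof.
move=> Tx; apply: h_inj; apply/lfunP => y; rewrite zero_lfunE.
by move/eqP: (hT x y); rewrite Tx linear0 eq_sym expf_eq0 q0 => /eqP.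
Qed.

(** * Orthogonals and totally isotropic lines *)

Lemma lker_formP x y : reflect (h x y = 0) (y \in lker (h x)).
Proof. by rewrite memv_ker; apply: eqP. Qed.

Lemma dim_lker_form x : x != 0 -> \dim (lker (h x)) = 3%N.
Proof.
move=> /h_neq0[y hxy]; have := limg_ker_dim (h x) fullv.
rewrite capfv dimV => E.
have img1 : \dim (limg (h x)) = 1%N.
  apply/eqP; rewrite eqn_leq lt0n dimv_eq0; apply/andP; split.
    by rewrite (leq_trans (dimvS (subvf _))) // dimvf.
  apply: contraNneq hxy => im0; rewrite -memv0 -im0.
  by rewrite memv_img ?memvf.
by move: E; rewrite img1 addn1 => -[].
Qed.

(* [h y = c *: h x = h (c^(1/q) *: x)] *)
Lemma sub_lker_form x y : x != 0 -> (lker (h x) <= lker (h y))%VS ->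
  y \in <[x]>%VS.
Proof.
move=> /h_neq0[u hxu] /subvP ker.
have [c cE] := closed_root_exists ((h y u : k) / h x u) q0.
apply/vlineP; exists c; apply/eqP; rewrite -subr_eq0 -scaleN1r; apply/eqP.
apply: h_inj; apply/lfunP => z; rewrite zero_lfunE hDl hZl.
have /lker_formP : z - ((h x z : k) / h x u) *: u \in lker (h y).
  apply/ker/lker_formP; rewrite linearB /= hZr divfK // subrr //.
rewrite linearB /= hZr hZl cE => /eqP; rewrite subr_eq0 => /eqP ->.
(* Additivity of the [q]-th power at [1 + (-1) = 0] covers characteristic 2 as well. *)
have -> : (-1) ^+ q = -1 :> k.
  have /eqP := exprDn_pchar 1 (-1) qk.
  by rewrite subrr expr0n gtn_eqF // expr1n addrC eq_sym addr_eq0 => /eqP.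
field.
exact: hxu.
Qed.

(** If [a], [b] span [L], the hyperplanes [lker (h a)] and [lker (h b)] differ by [sub_lker_form],
    so they meet in dimension at most 2. The intersection contains [L], hence equals it. *)
Lemma isoline_perp L y : isoline L -> (forall x, x \in L -> h x y = 0) ->
  y \in L.
Proof.
move=> [L2 Liso] hy; have [a [b [ab LE]]] := line2_basis L2.
have aL : a \in L by rewrite LE memvE addvSl.
have bL : b \in L by rewrite LE memvE addvSr.
have [b0 anb] : b != 0 /\ a \notin <[b]>%VS.
  by move: ab; rewrite free2P => /andP[].
have K3 := dim_lker_form b0.
have Ksub : (lker (h b) :&: lker (h a) <= lker (h b))%VS by apply: capvSl.
have K2 : (\dim (lker (h b) :&: lker (h a)) <= 2)%N.
  rewrite -ltnS -[X in (_ < X)%N]K3 (ltn_leqif (dimv_leqif_eq Ksub)).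
  by apply: contraNN anb => /eqP/capv_idPl; apply: sub_lker_form.
have KL : L = (lker (h b) :&: lker (h a))%VS.
  apply/eqP; rewrite eqEdim L2 K2 andbT; apply/subvP => x xL.
  by rewrite memv_cap !memv_ker !Liso ?eqxx.
by rewrite KL memv_cap !memv_ker !hy ?eqxx.
Qed.

Lemma isoline_T L x : isoline L -> x \in L -> T x \in L.
Proof.
move=> Lio xL; apply: (isoline_perp Lio) => y yL.
by rewrite hT Lio.2 // expr0n gtn_eqF.
Qed.

Lemma isoline_span x y : free [:: x; y] -> h x x = 0 -> h x y = 0 ->
  h y x = 0 -> h y y = 0 -> isoline (<[x]> + <[y]>)%VS.
Proof.
move=> xy hxx hxy hyx hyy; split; first exact: dim_line2.
move=> _ _ /memv_line2P[a [b ->]] /memv_line2P[c [d ->]].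
by rewrite hDl !hZl !linearD /= !hZr hxx hxy hyx hyy !(mulr0, addr0).
Qed.

(* On [x + t y] the form is [t h(x,y) + t^q h(y,x)]; take [t = 1], then [t] with
   [t^q - t = 1]. *)
Lemma isotropic_polarize (L : {vspace V}) : (forall x, x \in L -> h x x = 0) ->
  forall x y, x \in L -> y \in L -> h x y = 0.
Proof.
move=> Liso x y xL yL.
have E t : t * (h x y : k) + t ^+ q * (h y x : k) = 0.
  have := Liso (1 *: x + t *: y); rewrite memvD ?memvZ // => /(_ isT).
  rewrite hDl !linearD /= !hZr !hZl Liso // (Liso y) // !expr1n => E.
  by rewrite -[RHS]E; ring.
have [t tE] : exists t : k, t ^+ q - t - 1 = 0.
  have sX : size ('X + 1 : {poly k}) = 2%N by rewrite -polyC1 size_XaddC.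
  have /closed_rootP[t] : size ('X^q - ('X + 1) : {poly k}) != 1%N.
    rewrite size_polyDl ?size_polyN size_polyXn ?sX // ?ltnS //.
    by rewrite eqSS gtn_eqF.
  by rewrite /root !hornerE => /eqP tE; exists t; rewrite -[RHS]tE; ring.
have := E 1; rewrite expr1n !mul1r => /eqP; rewrite addrC addr_eq0 => /eqP yx.
have : (t ^+ q - t) * (h x y : k) = 0.
  by rewrite -[RHS]oppr0 -(E t) yx; ring.
have -> : t ^+ q - t = 1 by apply/eqP; rewrite -subr_eq0 tE.
by rewrite mul1r.
Qed.

(** Distinct lines share only the point [<[x]>]; as both are [T]-stable, so is that point. *)
Lemma isoline_meet L M x : isoline L -> isoline M -> L <> M -> x != 0 ->
  x \in L -> x \in M -> [/\ h x x = 0, T x \in <[x]>%VS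
    & forall y, y \in L -> y \in M -> y \in <[x]>%VS].
Proof.
move=> Lio Mio LM x0 xL xM.
have meet y : y \in L -> y \in M -> y \in <[x]>%VS.
  move=> yL yM; apply/negPn/negP => yx; apply: LM.
  by apply: (@line2_inj _ _ L M y x); rewrite ?Lio.1 ?Mio.1 // free2P yx.
by split=> //; [exact: Lio.2 | apply: meet; apply: isoline_T].
Qed.

Lemma hermpoint_meet L M P : isoline L -> isoline M -> L <> M ->
  \dim P = 1%N -> (P <= L)%VS -> (P <= M)%VS -> hermpoint P.
Proof.
move=> Lio Mio LM P1 PL PM.
have P0 : P != 0%VS by rewrite -dimv_eq0 P1.
have x0 : vpick P != 0 by rewrite vpick0.
have xP := memv_pick P.
have [||hxx Tx _] := isoline_meet Lio Mio LM x0.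
- exact: (subvP PL).
- exact: (subvP PM).
exists (vpick P); split=> //; apply/esym/eqP.
by rewrite eqEdim -memvE xP P1 dim_vline x0.
Qed.

Lemma T_line_neq0 x : x != 0 -> T x \in <[x]>%VS ->
  exists2 c, c != 0 & T x = c *: x.
Proof.
move=> x0 /vlineP[c Tx]; exists c => //.
apply: contraNneq x0 => c0; apply/eqP/T_inj.
by rewrite Tx c0 scale0r.
Qed.

(** For [T x = c x] the relation [hT] reads [c h(y, x) = h(x, y)^q] with [c] nonzero, so
    orthogonality to a [T]-stable point is symmetric. *)
Lemma herm_sym x y : x != 0 -> T x \in <[x]>%VS -> (h x y = 0) <-> (h y x = 0).
Proof.
move=> x0 /(T_line_neq0 x0)[c c0 Tx]; have := hT x y; rewrite Tx hZr => E.
split=> H.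
  move: E; rewrite H expr0n gtn_eqF // => /eqP.
  by rewrite mulf_eq0 (negPf c0) => /eqP.
by move/esym/eqP: E; rewrite H mulr0 expf_eq0 q0 => /eqP.
Qed.

Lemma T_free2 x y : free [:: x; y] -> free [:: T x; T y].
Proof.
move=> xy; have Q0 : (0 < q * q)%N by rewrite muln_gt0 q0.
apply: free2I => a b.
(* Writing the coefficients as [q * q]-th powers exhibits a relation between [T x] and [T y] as the
   image under [T] of one between [x] and [y]. *)
have [c <-] := closed_root_exists a Q0; have [d <-] := closed_root_exists b Q0.
rewrite -!TZ -TD => /T_inj/(free2_eq0 xy)[-> ->].
by rewrite expr0n gtn_eqF.
Qed.

Let qqk : [pchar k].-nat (q * q)%N. Proof. by rewrite pnatM qk. Qed.

Let qq1 : (1 < q * q)%N.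
Proof. by rewrite (ltn_trans q1) // -[X in (X < _)%N]muln1 ltn_pmul2l. Qed.

(** * Star points on a line and lines through a star point *)

Lemma isoline_hermpoints L : isoline L ->
  has_size (q * q).+1 (fun P => hermpoint P /\ (P <= L)%VS).
Proof.
move=> Lio; have [u [v [uv LE]]] := line2_basis Lio.1.
have uL : u \in L by rewrite LE memvE addvSl.
have vL : v \in L by rewrite LE memvE addvSr.
have [a [b TuE]] : exists a b, T u = a *: u + b *: v.
  by apply/memv_line2P; rewrite -LE isoline_T.
have [c [d TvE]] : exists a b, T v = a *: u + b *: v.
  by apply/memv_line2P; rewrite -LE isoline_T.
have Tuv := T_free2 uv.
have Tz x y : T (x *: u + y *: v) = (x ^+ (q * q) * a + y ^+ (q * q) * c) *: u
    + (x ^+ (q * q) * b + y ^+ (q * q) * d) *: v.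
  by rewrite TD !TZ TuE TvE !scalerDr !scalerA addrACA -!scalerDl.
(* The condition that [z = x u + y v] and [T z] be proportional is
   [x^Q (-b x + a y) + y^Q (-d x + c y) = 0] with [Q = q * q]; its determinant is [a d - b c], that
   of [T] on [L]. *)
have det : - b * c - a * - d != 0.
  apply: contraTneq Tuv => det.
  have /eqP bc : a * d - b * c = 0 by rewrite -det; ring.
  move: bc; rewrite subr_eq0 => /eqP bc.
  apply/negP => Tuv.
  (* If [a d = b c], then [d T u - b T v] and [c T u - a T v] both vanish, so [c = d = 0] and
     [T v = 0]. *)
  have [|d0 b0] := free2_eq0 (x := d) (y := - b) Tuv.
    rewrite TuE TvE !scalerDr !scalerA addrACA -!scalerDl.
    by rewrite [d * a]mulrC bc [d * b]mulrC !mulNr !subrr !scale0r addr0.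
  have [|c0 a0] := free2_eq0 (x := c) (y := - a) Tuv.
    rewrite TuE TvE !scalerDr !scalerA addrACA -!scalerDl.
    by rewrite [c * a]mulrC [c * b]mulrC -bc !mulNr !subrr !scale0r addr0.
  move: Tuv; rewrite free2P TvE c0 d0 !scale0r addr0 eqxx andbF //.
apply: has_size_ext (binary_form_points qqk qq1 det uv) => P.
split=> [[x [y [z0 -> E]]]|[[z [z0 -> hzz Tzz]] PL]].
  have zL : x *: u + y *: v \in L by rewrite memvD ?memvZ.
  rewrite -memvE; split=> //; exists (x *: u + y *: v); split=> //.
    exact: Lio.2.
  by rewrite Tz; apply/line2_mem => //; rewrite -E; ring.
have /memv_line2P[x [y zE]] : z \in (<[u]> + <[v]>)%VS by rewrite -LE memvE.
exists x, y; rewrite -zE; split=> //.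
move: Tzz z0; rewrite zE Tz => + z0 => /(line2_mem _ _ uv z0) <-; ring.
Qed.

Lemma form_binary u v x y : h (x *: u + y *: v) (x *: u + y *: v) =
  x ^+ q * ((h u u : k) * x + (h u v : k) * y)
  + y ^+ q * ((h v u : k) * x + (h v v : k) * y) :> k.
Proof. by rewrite hDl !linearD /= !hZr !hZl; ring. Qed.

(** A totally isotropic line through [<[x]>] lies in [K], the orthogonal of [x], and so corresponds
    to a point of a complement [C] of [<[x]>] in [K]. As [x] is orthogonal to [K] on both sides, the
    line is isotropic iff that point is a zero of the binary form of [h] on [C]. *)
Lemma hermpoint_isolines P : hermpoint P ->
  has_size q.+1 (fun L => isoline L /\ (P <= L)%VS).
Proof.
move=> [x [x0 -> hxx Txx]]; set K := lker (h x).
have xK : x \in K by apply/lker_formP.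
pose C := (K :\: <[x]>)%VS.
have xKE : (K :&: <[x]>)%VS = <[x]>%VS by apply/capv_idPr; rewrite -memvE.
have KE : K = (C + <[x]>)%VS by rewrite -[LHS](addv_diff_cap K <[x]>%VS) xKE.
have CK y : y \in C -> y \in K by apply/subvP; rewrite KE addvSl.
have Cx y : y \in C -> y \in <[x]>%VS -> y = 0.
  move=> yC yx; apply/eqP; rewrite -memv0 -(capv_diff K <[x]>%VS).
  by rewrite memv_cap yC.
have C2 : \dim C = 2%N.
  have := dimv_cap_compl K <[x]>%VS.
  by rewrite xKE dim_vline x0 dim_lker_form // add1n => -[].
have [u [v [uv CE]]] := line2_basis C2.
have uC : u \in C by rewrite CE memvE addvSl.
have vC : v \in C by rewrite CE memvE addvSr.
have hyx y : y \in K -> h y x = 0.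
  by move=> /lker_formP hxy; apply/(herm_sym y x0 Txx).
have freex z : z \in C -> z != 0 -> free [:: x; z].
  move=> zC z0; rewrite free2P z0 andbT; apply/negP => xz.
  case/eqP: x0; apply: Cx; last exact: memv_line.
  by move: xz => /vlineP[c ->]; rewrite memvZ.
(* A relation between the rows, with coefficients written as [q]-th powers, gives a nonzero [z] in
   [C] with [h z] zero on [C] and at [x], hence on [K]; then [sub_lker_form] puts [z] in [<[x]>]. *)
have det : (h u u : k) * (h v v : k) - (h u v : k) * (h v u : k) != 0.
  apply/negP => /eqP /det2_kernel[a [b []]].
  have [s <-] := closed_root_exists a q0; have [t <-] := closed_root_exists b q0.
  move=> hu hv; rewrite !expf_eq0 q0 /= => st.
  have zC : s *: u + t *: v \in C by rewrite memvD ?memvZ.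
  have z0 : s *: u + t *: v != 0.
    apply/negP => /eqP /(free2_eq0 uv)[s0 t0].
    by rewrite s0 t0 eqxx in st.
  case/negP: z0; apply/eqP/Cx => //; apply: sub_lker_form => //.
  apply/subvP => y; rewrite -/K KE => /memv_addP[w wC [_ /vlineP[c ->] ->]].
  apply/lker_formP; rewrite linearD /= hZr (hyx _ (CK _ zC)) mulr0 addr0.
  move: wC; rewrite CE => /memv_line2P[m [n ->]].
  rewrite linearD /= !hZr !hDl !hZl.
  by rewrite [X in m * X]hu [X in n * X]hv !mulr0 addr0.
have := has_size_map (f := fun U => (<[x]> + U)%VS) _
  (binary_form_points qk q1 det uv).
move=> /(_ _)/has_size_ext; apply.
- move=> L; split=> [[_ [s [t [z0 -> E]]] ->]|[Lio xL]].
    have zC : s *: u + t *: v \in C by rewrite memvD ?memvZ.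
    split; last exact: addvSl.
    apply: isoline_span; rewrite ?freex // ?hyx ?CK //.
      by apply/lker_formP/CK.
    by rewrite form_binary E.
  have [y yL yx] : exists2 y, y \in L & y \notin <[x]>%VS.
    apply/subvPn; apply/negP => /dimvS.
    by rewrite Lio.1 dim_vline x0.
  have {}xL : x \in L by rewrite memvE.
  have : y \in K by apply/lker_formP/Lio.2.
  (* The [C]-component [z] of a point of [L] other than [<[x]>] spans [L] together with [x]. *)
  rewrite KE => /memv_addP[z zC [_ /vlineP[c ->] yE]].
  have zL : z \in L by rewrite -(addrK (c *: x) z) -yE memvB ?memvZ.
  have z0 : z != 0.
    by apply: contraNneq yx => z0; rewrite yE z0 add0r memvZ ?memv_line.
  exists <[z]>%VS; last by rewrite (line2E Lio.1 (freex z zC z0)).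
  move: (zC); rewrite CE => /memv_line2P[s [t zE]].
  by exists s, t; rewrite -zE; split=> //; rewrite -form_binary -zE Lio.2.
- move=> _ _ [s [t [z0 -> _]]] [s' [t' [z0' -> _]]] E.
  have zC : s *: u + t *: v \in C by rewrite memvD ?memvZ.
  have zC' : s' *: u + t' *: v \in C by rewrite memvD ?memvZ.
  apply: vline_eq => //.
  have : s *: u + t *: v \in (<[x]> + <[s' *: u + t' *: v]>)%VS.
    by rewrite -E memvE addvSr.
  move=> /memv_line2P[c [d zE]].
  have cx : c *: x = 0.
    apply: Cx; last by rewrite memvZ ?memv_line.
    by rewrite -(addrK (d *: (s' *: u + t' *: v)) (c *: x)) -zE memvB ?memvZ.
  by rewrite zE cx add0r memvZ ?memv_line.
Qed.

(** * Existence of a star point *)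

(** Take [x] fixed by [T], then [y] fixed by [T] in the [T]-stable orthogonal of [x]. If neither is
    isotropic, the form on their span is diagonal and nondegenerate, and any zero [z] of it turns
    out to be [T]-stable. *)
Lemma exists_hermpoint : exists P, hermpoint P.
Proof.
have fixed (W : {vspace V}) : (forall x, x \in W -> T x \in W) ->
    W != 0%VS -> exists x, [/\ x \in W, x != 0 & T x = x].
  exact: (frobenius_fixed_vector qq1 TD TZ T_inj).
have [||x [_ x0 Tx]] := fixed fullv; first by move=> *; rewrite memvf.
  by rewrite -dimv_eq0 dimV.
have Txx : T x \in <[x]>%VS by rewrite Tx memv_line.
have [hxx|hxx] := eqVneq (h x x) 0; first by exists <[x]>%VS, x.
have [||y [yK y0 Ty]] := fixed (lker (h x)).
- move=> y /lker_formP/(herm_sym y x0 Txx) hyx; apply/lker_formP.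
  by rewrite hT hyx expr0n gtn_eqF.
- by rewrite -dimv_eq0 dim_lker_form.
have hxy : h x y = 0 by apply/lker_formP.
have hyx : h y x = 0 by apply/(herm_sym y x0 Txx).
have Tyy : T y \in <[y]>%VS by rewrite Ty memv_line.
have [hyy|hyy] := eqVneq (h y y) 0; first by exists <[y]>%VS, y.
have xy : free [:: x; y].
  rewrite free2P y0 andbT; apply/negP => /vlineP[c xE]; case/negP: hxx.
  by rewrite {2}xE hZr hxy mulr0.
have det : (h x x : k) * (h y y : k) - (h x y : k) * (h y x : k) != 0.
  by rewrite hxy mul0r subr0 mulf_neq0.
have [[|P r] [_ rsize rP]] := binary_form_points qk q1 det xy; first by [].
have [s [t [z0 _]]] := (rP P).2 (mem_head _ _); rewrite -form_binary => hzz.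
set z := s *: x + t *: y in z0 hzz.
exists <[z]>%VS, z; split=> //.
have TzE : T z = s ^+ (q * q) *: x + t ^+ (q * q) *: y.
  by rewrite TD !TZ Tx Ty.
(* On the span of [x] and [y], the functional [h z] has coefficients [A = s^q h(x, x)] and
   [B = t^q h(y, y)]. It kills both [z] and [T z]; were these independent, [A] and [B] would vanish,
   forcing [s = t = 0]. *)
have hzTz : h z (T z) = 0 by rewrite hT hzz expr0n gtn_eqF.
have hzE a b : h z (a *: x + b *: y) = s ^+ q * (h x x : k) * a
    + t ^+ q * (h y y : k) * b :> k.
  by rewrite linearD /= !hZr !hDl !hZl hxy hyx; ring.
rewrite TzE; apply/line2_mem => //.
move: hzz hzTz; rewrite TzE {2}/z !hzE.
set A := s ^+ q * _; set B := t ^+ q * _ => E1 E2.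
apply/eqP/negPn/negP => w0.
have A0 : A = 0.
  apply/eqP; rewrite -[_ == _]orbF -(negPf w0) -mulf_eq0; apply/eqP.
  transitivity ((A * s ^+ (q * q) + B * t ^+ (q * q)) * t
    - (A * s + B * t) * t ^+ (q * q)); first by ring.
  by rewrite E1 E2 !mul0r subrr.
have B0 : B = 0.
  apply/eqP; rewrite -[_ == _]orbF -(negPf w0) -mulf_eq0; apply/eqP.
  transitivity ((A * s + B * t) * s ^+ (q * q)
    - (A * s ^+ (q * q) + B * t ^+ (q * q)) * s); first by ring.
  by rewrite E1 E2 !mul0r subrr.
move/eqP: A0; rewrite mulf_eq0 (negPf hxx) orbF expf_eq0 q0 /= => /eqP s0.
move/eqP: B0; rewrite mulf_eq0 (negPf hyy) orbF expf_eq0 q0 /= => /eqP t0.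
by move: z0; rewrite /z s0 t0 !scale0r addr0 eqxx.
Qed.

(** * Projection onto a line and the global counts *)

Lemma hermpoint_free P R : hermpoint P -> hermpoint R -> R <> P ->
  exists p r, [/\ P = <[p]>%VS, R = <[r]>%VS & free [:: p; r]].
Proof.
move=> [p [p0 -> _ _]] [r [r0 -> _ _]] RP; exists p, r; split=> //.
rewrite free2P r0 andbT; apply/negP => pr; apply: RP.
by rewrite (vline_eq p0 pr).
Qed.

Lemma isoline_inj L M P R : isoline L -> isoline M -> hermpoint P ->
  hermpoint R -> R <> P -> (P <= L)%VS -> (R <= L)%VS -> (P <= M)%VS ->
  (R <= M)%VS -> L = M.
Proof.
move=> [L2 _] [M2 _] hP hR RP.
have [p [r [-> -> pr]]] := hermpoint_free hP hR RP.
by rewrite -!memvE => *; apply: (line2_inj L2 M2 pr).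
Qed.

(** The candidate is a point [y] of [L] orthogonal to [r], which exists because [2 + 3 > 4]. *)
Lemma exists_projection L R : isoline L -> hermpoint R -> ~ (R <= L)%VS ->
  exists P M, [/\ hermpoint P, (P <= L)%VS, isoline M, (P <= M)%VS
    & (R <= M)%VS].
Proof.
move=> Lio [r [r0 -> hrr Trr]]; rewrite -memvE => rL.
have LK0 : (L :&: lker (h r))%VS != 0%VS.
  have := dimv_sum_cap L (lker (h r)).
  have := dimvS (subvf (L + lker (h r))).
  by rewrite -dimv_eq0 Lio.1 dim_lker_form // dimV; lia.
set y := vpick (L :&: lker (h r))%VS.
have y0 : y != 0 by rewrite vpick0.
have /andP[yL /lker_formP hry] : (y \in L) && (y \in lker (h r)).
  by rewrite -memv_cap memv_pick.
have hyr : h y r = 0 by apply/(herm_sym y r0 Trr).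
have Tyy : T y \in <[y]>%VS.
  (* Otherwise [y] and [T y] span [L]; since [h(r, T y) = h(y, r)^q = 0], the vector [r] is
     orthogonal to [L] and so lies on it. *)
  apply/negPn/negP => Tyy; apply: rL; apply: (isoline_perp Lio) => x.
  have TyL := isoline_T Lio yL.
  rewrite (@line2E _ _ L (T y) y) ?free2P ?Tyy ?Lio.1 //.
  move=> /memv_line2P[a [b ->]]; apply/(herm_sym _ r0 Trr).
  have hrTy : h r (T y) = 0 by rewrite hT hyr expr0n gtn_eqF.
  by apply/lker_formP; rewrite memvD ?memvZ //; apply/lker_formP.
exists <[y]>%VS, (<[r]> + <[y]>)%VS; split.
- by exists y; split=> //; apply: Lio.2.
- by rewrite -memvE.
- apply: isoline_span => //; last exact: Lio.2.
  rewrite free2P y0 andbT; apply/negP => /vlineP[c rE].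
  by apply: rL; rewrite rE memvZ.
- exact: addvSr.
- exact: addvSl.
Qed.

(** Two different points would span [L], so [R] would be orthogonal to all of [L] and lie on it by
    [isoline_perp]. *)
Lemma projection_uniq L M M' P P' R : isoline L -> isoline M -> isoline M' ->
  hermpoint P -> hermpoint P' -> (P <= L)%VS -> (P' <= L)%VS ->
  (P <= M)%VS -> (P' <= M')%VS -> (R <= M)%VS -> (R <= M')%VS ->
  ~ (R <= L)%VS -> P = P'.
Proof.
move=> Lio Mio M'io hP hP' PL P'L PM P'M' RM RM' RL.
have [//|PP'] := eqVneq P P'; case: RL; apply/subvP => r rR.
have [p' [p [P'E PE pp']]] := hermpoint_free hP' hP (elimN eqP PP').
move: PL P'L PM P'M'; rewrite {}PE {}P'E -!memvE => pL p'L pM p'M'.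
apply: (isoline_perp Lio) => x; rewrite (line2E Lio.1 pp' p'L pL).
move=> /memv_line2P[a [b ->]]; rewrite hDl !hZl.
have hp : h p r = 0 :> k by apply: Mio.2; last exact: (subvP RM).
have hp' : h p' r = 0 :> k by apply: M'io.2; last exact: (subvP RM').
by rewrite hp hp' !mulr0 addr0.
Qed.

Lemma hermpoint_count :
  has_size ((q * q).+1 * (q * (q * q)).+1)%N hermpoint.
Proof.
have [P0 hP0] := exists_hermpoint.
have [[|L r] [_ rsize rP]] := hermpoint_isolines hP0; first by [].
have [Lio _] := (rP L).2 (mem_head _ _).
have onL := isoline_hermpoints Lio.
(* [A P] collects the star points projecting from outside [L] to [P]: there are [q] lines [M]
   through [P] other than [L], each with [q * q] star points besides [P]. *)
pose A P R := exists M, ((isoline M /\ (P <= M)%VS) /\ M <> L)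
  /\ ((hermpoint R /\ (R <= M)%VS) /\ R <> P).
have As P : hermpoint P /\ (P <= L)%VS -> has_size (q * (q * q))%N (A P).
  move=> [hP PL]; apply: has_size_bigU => [M M' R||M].
  - move=> [[Mio PM] _] [[M'io PM'] _] [[hR RM] RP] [[_ RM'] _].
    exact: (isoline_inj Mio M'io hP hR RP).
  - by apply: has_size_D1 (hermpoint_isolines hP).
  - move=> [[Mio PM] _].
    by apply: has_size_D1 (isoline_hermpoints Mio).
have offL P R : hermpoint P -> (P <= L)%VS -> A P R -> ~ (R <= L)%VS.
  move=> hP PL [M [[[Mio PM] ML] [[hR RM] RP]]] RL; apply: ML.
  exact: (isoline_inj Mio Lio hP hR RP).
have disj P P' R : hermpoint P /\ (P <= L)%VS -> hermpoint P' /\ (P' <= L)%VS ->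
    A P R -> A P' R -> P = P'.
  move=> [hP PL] [hP' P'L] APR; have RL := offL _ _ hP PL APR.
  case: APR => M [[[Mio PM] _] [[_ RM] _]] [M' [[[M'io P'M'] _] [[_ RM'] _]]].
  exact: (projection_uniq Lio Mio M'io hP hP' PL P'L PM P'M' RM RM').
have off := has_size_bigU disj onL As.
rewrite mulnS; apply: has_size_ext (has_size_U _ onL off) => R.
- split=> [[[]//|[P [_ [M [_ [[]]]]]]//]|hR].
  have [RL|/negP RL] := boolP (R <= L)%VS; [by left|right].
  have [P [M [hP PL Mio PM RM]]] := exists_projection Lio hR RL.
  exists P; split=> //; exists M; split; split=> //.
    by move=> ML; apply: RL; rewrite -ML.
  by move=> RP; apply: RL; rewrite RP.
- by move=> [_ RL] [P [[hP PL] /offL]]; apply.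
Qed.

Lemma isoline_count : has_size ((q * (q * q)).+1 * q.+1)%N isoline.
Proof.
have [n] := has_size_double_count (I := fun P L => (P <= L)%VS) (ltn0Sn _)
  hermpoint_count hermpoint_isolines isoline_hermpoints.
(* Both counts of flags contain the factor [q^2 + 1], which cancels. *)
rewrite mulnC -mulnA => ns /eqP; rewrite eqn_pmul2l // => /eqP <-.
exact: ns.
Qed.

End FrobeniusGeometry.

(** * Forms given by a matrix *)

Lemma linear_formE (R : nzRingType) (n : nat) (p : {mpoly R[n]}) :
  p \is 1.-homog -> p = \sum_(j < n) p@_U_(j) *: 'X_j.
Proof.
move=> p1; apply/mpolyP => m; rewrite raddf_sum /=.
have [/mdeg1P[i /eqP ->]|m1] := boolP (mdeg m == 1%N).
  rewrite (bigD1 i) //= mcoeffZ mcoeffX eqxx mulr1 big1 ?addr0 // => j ji.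
  rewrite mcoeffZ mcoeffX; case: eqP => [/mnmP/(_ j)|_]; last by rewrite mulr0.
  by rewrite !mnm1E eqxx eq_sym (negPf ji).
rewrite (dhomog_nemf_coeff p1) // big1 // => j _.
rewrite mcoeffZ mcoeffX; case: eqP => [E|_]; last by rewrite mulr0.
by rewrite -E mdeg1 in m1.
Qed.

Definition frob_pow (R : pzSemiRingType) (n q : nat) (x : 'rV[R]_n) :
  'rV[R]_n := map_mx (fun c => c ^+ q) x.

Section FrobeniusMatrix.

Variables (k : closedFieldType) (n q : nat) (A : 'M[k]_n).

(** The target is [k^o], since ['Hom] takes values in a vector space. *)
Definition frob_pairing (x y : 'rV[k]_n) : k^o :=
  \sum_i \sum_j x 0 i ^+ q * A i j * y 0 j.

Lemma frob_pairing_linear x : linear (frob_pairing x).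
Proof.
move=> c y z; rewrite /frob_pairing scaler_sumr -big_split; apply: eq_bigr => i _.
rewrite scaler_sumr -big_split; apply: eq_bigr => j _ /=.
by rewrite !mxE /GRing.scale /=; ring.
Qed.

HB.instance Definition _ x := GRing.isLinear.Build k 'rV[k]_n k^o _
  (frob_pairing x) (frob_pairing_linear x).

Definition frob_hom x : 'Hom('rV[k]_n, k^o) := linfun (frob_pairing x).

Lemma frob_homE x y : frob_hom x y = (frob_pow q x *m A *m y^T) 0 0.
Proof.
rewrite lfunE /= /frob_pairing exchange_big mxE; apply: eq_bigr => j _ /=.
by rewrite mxE mulr_suml mxE; apply: eq_bigr => i _; rewrite mxE.
Qed.

Hypotheses (qk : [pchar k].-nat q) (q1 : (1 < q)%N).
Hypothesis A_inj : forall x, frob_pow q x *m A = 0 -> x = 0.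

Let q0 : (0 < q)%N. Proof. exact: ltnW. Qed.

Lemma frob_homD x y : frob_hom (x + y) = frob_hom x + frob_hom y.
Proof.
apply/lfunP => z; rewrite add_lfunE !frob_homE.
have -> : frob_pow q (x + y) = frob_pow q x + frob_pow q y.
  by apply/rowP => i; rewrite !mxE exprDn_pchar.
by rewrite !mulmxDl mxE.
Qed.

Lemma frob_homZ c x : frob_hom (c *: x) = c ^+ q *: frob_hom x.
Proof.
apply/lfunP => z; rewrite scale_lfunE !frob_homE.
have -> : frob_pow q (c *: x) = c ^+ q *: frob_pow q x.
  by apply/rowP => i; rewrite !mxE exprMn.
by rewrite -!scalemxAl mxE.
Qed.

Lemma frob_hom_inj x : frob_hom x = 0 -> x = 0.
Proof.
move=> hx; apply: A_inj; apply/rowP => j; rewrite [RHS]mxE.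
have := frob_homE x (delta_mx 0 j); rewrite hx zero_lfunE trmx_delta -colE mxE.
by move=> <-.
Qed.

(** Every row vector over [k] is a [frob_pow], so [A_inj] excludes any left kernel. *)
Lemma frob_matrix_unit : A \in unitmx.
Proof.
rewrite -row_free_unit -kermx_eq0; apply/rowV0P => u /sub_kermxP uA.
have /fin_all_exists[x xE] : forall i, exists c, c ^+ q = u 0 i.
  by move=> i; apply: closed_root_exists.
have fx : frob_pow q (\row_i x i) = u by apply/rowP => i; rewrite !mxE xE.
have x0 : \row_i x i = 0 by apply: A_inj; rewrite fx.
by rewrite -fx x0; apply/rowP => i; rewrite !mxE expr0n gtn_eqF.
Qed.

Lemma frob_hom_nondeg y : (forall x, frob_hom x y = 0) -> y = 0.
Proof.
move=> hy; suff : A *m y^T = 0.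
  move=> /(congr1 (mulmx (invmx A))); rewrite mulKmx ?frob_matrix_unit //.
  by rewrite mulmx0 => /(congr1 trmx); rewrite trmxK trmx0.
apply/colP => i; rewrite [RHS]mxE; have := hy (delta_mx 0 i).
rewrite frob_homE -mulmxA (_ : frob_pow q _ = delta_mx 0 i).
  by rewrite -rowE mxE.
apply/rowP => j; rewrite !mxE; case: (_ && _); first exact: expr1n.
by rewrite expr0n gtn_eqF.
Qed.

Lemma map_mx_expM m l r (B : 'M[k]_(m, l)) (C : 'M[k]_(l, r)) :
  map_mx (fun c => c ^+ q) (B *m C)
    = map_mx (fun c => c ^+ q) B *m map_mx (fun c => c ^+ q) C.
Proof.
apply/matrixP => i j; rewrite !mxE.
rewrite (big_morph _ (fun x y => exprDn_pchar x y qk) (expr0n _ _)).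
rewrite gtn_eqF //; apply: eq_bigr => l' _.
by rewrite !mxE exprMn.
Qed.

(** Since [(x^(q) A y^T)^q = y^(q) (A^(q))^T (x^(q^2))^T], the equation [h(y, T x) = h(x, y)^q] is
    solved by [(T x)^T = A^-1 (A^(q))^T (x^(q^2))^T]. *)
Definition frob_adjoint (x : 'rV[k]_n) : 'rV[k]_n :=
  (invmx A *m (map_mx (fun c => c ^+ q) A)^T *m (frob_pow q (frob_pow q x))^T)^T.

Lemma frob_adjointP x y :
  frob_hom y (frob_adjoint x) = (frob_hom x y : k) ^+ q.
Proof.
rewrite !frob_homE /frob_adjoint trmxK -mulmxA !mulmxA.
rewrite mulmxK ?frob_matrix_unit // -[RHS]/((fun c => c ^+ q) _).
have -> (M : 'M[k]_1) : (fun c => c ^+ q) (M 0 0)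
    = (map_mx (fun c => c ^+ q) M)^T 0 0 by rewrite !mxE.
by rewrite !map_mx_expM !trmx_mul (map_trmx _ y^T) trmxK mulmxA.
Qed.

End FrobeniusMatrix.

(** The rows of [A] are the coefficients of the linear forms. Differentiation kills [X_i^q], so the
    gradient at [v] is [v^(q) A], which ties smoothness to the injectivity of [A]. *)
Lemma frobenius_form_matrix (k : fieldType) (n q : nat) (F : {mpoly k[n]}) :
  q%:R = 0 :> k -> (1 < q)%N -> frobenius_form q F ->
  exists A : 'M[k]_n, forall v : 'rV[k]_n,
    F.@[v 0] = (frob_pow q v *m A *m v^T) 0 0 /\
    forall j, (F^`M(j)).@[v 0] = (frob_pow q v *m A) 0 j.
Proof.
move=> qk q1 [_ [L [L1 ->]]].
exists (\matrix_(i, j) (L i)@_U_(j)) => v; split=> [|j].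
  rewrite raddf_sum -mulmxA mxE; apply: eq_bigr => i _ /=.
  rewrite mevalM rmorphXn /= mevalXU mxE; congr (_ * _).
  rewrite {1}(linear_formE (L1 i)) raddf_sum mxE; apply: eq_bigr => j _ /=.
  by rewrite mevalZ mevalXU !mxE.
have Xq i : ('X_i ^+ q : {mpoly k[n]})^`M(j) = 0.
  by rewrite mpolyXn mderivX mulmnE natrM qk mulr0 scale0r.
have dL i : (L i)^`M(j) = ((L i)@_U_(j))%:MP.
  rewrite {1}(linear_formE (L1 i)) raddf_sum (bigD1 j) //= big1 => [|l lj].
    rewrite mderivZ mderivX mnm1E eqxx scale1r addr0.
    rewrite (_ : (_ - _)%MM = 0%MM) ?mpolyX0; first by rewrite -mul_mpolyC mulr1.
    by apply/mnmP => l; rewrite mnmBE subnn mnm0E.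
  by rewrite mderivZ mderivX mnm1E (negPf lj) scale0r scaler0.
rewrite (linear_sum (mderiv j)) raddf_sum mxE; apply: eq_bigr => i _ /=.
by rewrite mderivM Xq mul0r add0r dL mevalM mevalC rmorphXn /= mevalXU !mxE.
Qed.

(** If [S] missed a point of [A], it would lie in a set of size [n - 1]. This identifies a star with
    the set of all lines through its center. *)
Lemma has_size_sub_eq (T : choiceType) (n : nat) (A S : set T) :
  has_size n A -> (S `<=` A)%classic -> (S #= `I_n)%card -> S = A.
Proof.
move=> An SA Sn; apply/seteqP; split=> // x Ax; apply: contrapT => nSx.
case: n An Sn => [[s [_ /size0nil -> /(_ x)[/(_ Ax)]]]//|n] An Sn.
have /has_size_card Axn := has_size_D1 Ax An.
have /subset_card_le : (S `<=` [set y | A y /\ y <> x])%classic.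
  by move=> y Sy; split; [exact: SA|move=> yx; apply: nSx; rewrite -yx].
by rewrite (card_le_eql Sn) (card_le_eqr Axn) card_le_II ltnn.
Qed.

(** * Lines and stars of the surface *)

Section ExtremalSurface.
Variables (k : closedFieldType) (q : nat) (F : {mpoly k[4]}) (A : 'M[k]_4).
Hypotheses (qk : [pchar k].-nat q) (q1 : (1 < q)%N).
Hypothesis FE : forall v : 'rV[k]_4, F.@[v 0] = (frob_pow q v *m A *m v^T) 0 0.
Hypothesis A_inj : forall x, frob_pow q x *m A = 0 -> x = 0.

Let h := frob_hom q A.
Let T := frob_adjoint q A.
Let hD := frob_homD A qk.
Let hZ := frob_homZ q A.
Let h_inj := frob_hom_inj A_inj.
Let h_nondeg := frob_hom_nondeg q1 A_inj.
Let hT := frob_adjointP qk q1 A_inj.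

Let dimV : \dim {:'rV[k]_4} = 4%N.
Proof. by rewrite dimvf /dim /= mul1n. Qed.

Lemma line_onP L : line_on F L <-> isoline h L.
Proof.
split=> -[L2 HL]; split=> //; last first.
  by move=> v vL; rewrite FE -frob_homE HL.
apply: (isotropic_polarize q1 hD hZ) => x xL.
by rewrite frob_homE -FE HL.
Qed.

Lemma hermpoint_lines P : hermpoint h T P ->
  has_size q.+1 [set L | line_on F L /\ (P <= L)%VS]%classic.
Proof.
move=> hP; apply: has_size_ext
  (hermpoint_isolines qk q1 dimV hD hZ h_inj hT hP) => L.
by rewrite /mkset line_onP.
Qed.

(** As [q + 1 >= 2], the center lies on two distinct lines and is a [hermpoint]; exactly [q + 1]
    lines then pass through it, so [S] contains them all. *)
Lemma star_center P S : star_centered_at q.+1 F P S ->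
  hermpoint h T P /\ S = [set L | line_on F L /\ (P <= L)%VS]%classic.
Proof.
move=> [P1 Sq SP]; have hP : hermpoint h T P.
  have /eq_cardSP[L SL] := Sq.
  rewrite -(prednK (ltnW q1)) => /eq_cardSP[M [SM ML] _].
  have [/line_onP Lio PL] := SP L SL; have [/line_onP Mio PM] := SP M SM.
  apply: (hermpoint_meet qk q1 dimV hD hZ h_inj hT Lio Mio) => // LM.
  by apply: ML.
by split=> //; apply: has_size_sub_eq (hermpoint_lines hP) SP Sq.
Qed.

Lemma hermpoint_star P : hermpoint h T P ->
  star_centered_at q.+1 F P [set L | line_on F L /\ (P <= L)%VS]%classic.
Proof.
move=> hP; split=> //; last exact: has_size_card (hermpoint_lines hP).
by case: hP => x [x0 -> _ _]; rewrite /is_point dim_vline x0.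
Qed.

Lemma star_pointP P : star_point q.+1 F P <-> hermpoint h T P.
Proof.
split=> [[S /star_center[]]//|hP].
by exists [set L | line_on F L /\ (P <= L)%VS]%classic; apply: hermpoint_star.
Qed.

Lemma line_on_count : has_size ((q * (q * q)).+1 * q.+1)%N (line_on F).
Proof.
apply: has_size_ext (isoline_count qk q1 dimV hD hZ h_inj h_nondeg hT) => L.
by rewrite line_onP.
Qed.

Lemma line_on_star_points L : line_on F L ->
  has_size (q * q).+1 [set P | star_point q.+1 F P /\ (P <= L)%VS]%classic.
Proof.
move=> /line_onP Lio; apply: has_size_ext
  (isoline_hermpoints qk q1 dimV hD hZ h_inj h_nondeg hT Lio) => P.
by rewrite /mkset star_pointP.
Qed.

Lemma star_count :
  ([set S | star q.+1 F S] #= `I_((q * q).+1 * (q * (q * q)).+1))%card.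
Proof.
pose f P := [set L | line_on F L /\ (P <= L)%VS]%classic.
have -> : ([set S | star q.+1 F S] = [set f P | P in hermpoint h T])%classic.
  apply/seteqP; split=> S /= [P]; first by move=> /star_center[hP ->]; exists P.
  by move=> hP <-; exists P; apply: hermpoint_star.
have := hermpoint_count qk q1 dimV hD hZ h_inj h_nondeg hT.
move=> /has_size_card; apply: card_eq_trans; apply: inj_card_eq.
(* A star determines its center: two distinct lines of the star cannot share two points. *)
move=> P R /set_mem hP /set_mem hR fPR; apply: contrapT => PR.
have [[|L [|M s]] [us sq sP]] := hermpoint_lines hP.
- by [].
- by move: q1; case: sq => <-.
have [|Lon PL] := (sP L).2; first by rewrite mem_head.
have [|Mon PM] := (sP M).2; first by rewrite !inE eqxx orbT.
have [_ RL] : f R L by rewrite -fPR.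
have [_ RM] : f R M by rewrite -fPR.
move/line_onP: Lon => Lio; move/line_onP: Mon => Mio.
have LM : L = M by apply: (isoline_inj Lio Mio hP hR) => // RP; apply: PR.
by move: us; rewrite LM /= mem_head.
Qed.

End ExtremalSurface.

Local Open Scope classical_set_scope.
Local Open Scope card_scope.
Local Open Scope nat_scope.

Theorem corollary3p2p3 (k : closedFieldType) (p e q : nat)
    (hp : p \in [pchar k]%R) (he : 1 <= e) (hq : q = p ^ e)
    (F : {mpoly k[4]}) (hF : frobenius_form q F) (hsm : smooth_surface F) :
  [/\ q ^ 4 + q ^ 3 + q + 1 = (q ^ 3 + 1) * (q + 1),
      [set L | line_on F L] #= `I_(q ^ 4 + q ^ 3 + q + 1)
    & forall L, line_on F L ->
        [set P | star_point q.+1 F P /\ (P <= L)%VS] #= `I_(q ^ 2 + 1)]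
  /\
  [/\ q ^ 5 + q ^ 3 + q ^ 2 + 1 = (q ^ 3 + 1) * (q ^ 2 + 1),
      [set S | star q.+1 F S] #= `I_(q ^ 5 + q ^ 3 + q ^ 2 + 1),
      forall S, star q.+1 F S -> S #= `I_(q + 1)
    & forall P, star_point q.+1 F P ->
        [set L | line_on F L /\ (P <= L)%VS] #= `I_(q + 1)].
Proof.
have p_pr := pcharf_prime hp.
have qk : ([pchar k]%R).-nat q by rewrite hq pnatX pnatE // hp.
have q1 : 1 < q.
  rewrite hq; apply: leq_trans (prime_gt1 p_pr) _.
  by rewrite -{1}[p]expn1 leq_pexp2l // prime_gt0.
have [A FA] := frobenius_form_matrix (pchar_nat_eq0 qk q1) q1 hF.
have FE v := (FA v).1.
(* At a nonzero [x] with [x^(q) A = 0], both [F] and its gradient would vanish, against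
   smoothness. *)
have A_inj x : (frob_pow q x *m A = 0 -> x = 0)%R.
  move=> xA; apply/eqP/negPn/negP => /hsm; rewrite FE xA mul0mx mxE.
  by move=> /(_ erefl)[i]; rewrite (FA x).2 xA mxE eqxx.
have E4 : q ^ 4 + q ^ 3 + q + 1 = (q * (q * q)).+1 * q.+1.
  by rewrite -[(q * (q * q)).+1]addn1 -[q.+1]addn1; ring.
have E5 : q ^ 5 + q ^ 3 + q ^ 2 + 1 = (q * q).+1 * (q * (q * q)).+1.
  by rewrite -[(q * q).+1]addn1 -[(q * (q * q)).+1]addn1; ring.
split; split.
- by ring.
- by rewrite E4; apply: has_size_card (line_on_count qk q1 FE A_inj).
- move=> L /(line_on_star_points qk q1 FE A_inj)/has_size_card.
  by rewrite addn1 -mulnn.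
- by ring.
- by rewrite E5; apply: star_count qk q1 FE A_inj.
- by move=> S [P []]; rewrite addn1.
- move=> P /(star_pointP qk q1 FE A_inj)/(hermpoint_lines qk q1 FE A_inj).
  by rewrite addn1 => /has_size_card.
Qed.
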